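(* Let $G$ and $H$ be two arbitrary subcubic graphs. Then $\chi''_{\prod}(G\circ H)\leq \Delta(G\circ H)+3$, where $G\circ H$ is the corona product of $G$ and $H$; that is, for some $k\le \Delta(G\circ H)+3$ the graph $G\circ H$ admits a neighbor product distinguishing $[k]$-total coloring.
   Context: All graphs are finite, simple and undirected, with at least one vertex. $\Delta(F)$ denotes the maximum degree of a graph $F$, and $F$ is subcubic if $\Delta(F)\le 3$. Corona product: given graphs $G$ and $H$ with $n_g=|V(G)|$, $n_h=|V(H)|$, $V(G)=\{v_1,\dots,v_{n_g}\}$ and $V(H)=\{u_1,\dots,u_{n_h}\}$, the corona product $G\circ H$ is obtained by taking one copy of $G$ and $n_g$ disjoint copies $H_1,\dots,H_{n_g}$ of $H$, and joining, for each $1\le j\le n_g$, the vertex $v_j$ of $G$ to every vertex $u_i^j$ ($1\le i\le n_h$) of $H_j$, where $u_i^j$ is the copy of $u_i$ in $H_j$. Total coloring: for a positive integer $k$, let $[k]=\{1,2,\dots,k\}$. A (proper) $[k]$-total coloring of a graph $F$ is a map $c:V(F)\cup E(F)\to[k]$ such that $c(x)\ne c(y)$ whenever $x,y\in V(F)\cup E(F)$ are two adjacent vertices, two distinct edges sharing an endpoint, or a vertex and an edge incident with it. For a vertex $v$ of $F$, let $\prod(v)=c(v)\cdot\prod_{e\ni v}c(e)$ be the product (as integers) of the color of $v$ and the colors of all edges incident with $v$. The coloring $c$ is a neighbor product distinguishing total coloring if $\prod(u)\ne\prod(v)$ for every edge $uv\in E(F)$. $\chi''_{\prod}(F)$ denotes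 the smallest positive integer $k$ such that $F$ admits a neighbor product distinguishing $[k]$-total coloring. *)

(* Defs.v *)
From mathcomp Require Import all_boot.

Set Implicit Arguments.
Unset Strict Implicit.
Unset Printing Implicit Defensive.

Record graph := Graph {
  vertex :> finType;
  adj : rel vertex;
  adj_sym : symmetric adj;
  adj_irr : irreflexive adj;
  vertex_gt0 : 0 < #|vertex| }.

Definition degree (F : graph) (v : F) : nat := #|[set w | adj v w]|.

Definition max_degree (F : graph) : nat := \max_(v : F) degree v.

Definition subcubic (F : graph) : bool := max_degree F <= 3.

Definition edges (F : graph) : {set {set F}} :=
  [set e : {set F} | [exists x, exists y, adj x y && (e == [set x; y])]].

Definition edge (F : graph) : finType := {e : {set F} | e \in edges F}.

(* V(F) ∪ E(F) *)
Definition element (F : graph) : finType := (F + edge F)%type.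

Section Corona.
Variables G H : graph.

(* [inl v] is the vertex v of G, and [inr (v, u)] is the copy of u in the copy
   of H attached to v. *)
Definition corona_vertex : finType := (G + G * H)%type.

Definition corona_adj (x y : corona_vertex) : bool :=
  match x, y with
  | inl v, inl w => adj v w
  | inl v, inr (w, _) => v == w
  | inr (v, _), inl w => v == w
  | inr (v, u), inr (w, t) => (v == w) && adj u t
  end.

Lemma corona_adj_sym : symmetric corona_adj.
Proof.
by move=> [v|[v u]] [w|[w t]] //=; rewrite ?[v == w]eq_sym // adj_sym.
Qed.

Lemma corona_adj_irr : irreflexive corona_adj.
Proof. by move=> [v|[v u]] /=; rewrite adj_irr ?andbF. Qed.

Lemma corona_vertex_gt0 : 0 < #|corona_vertex|.
Proof. by rewrite card_sum addn_gt0 vertex_gt0. Qed.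

Definition corona : graph :=
  Graph corona_adj_sym corona_adj_irr corona_vertex_gt0.

End Corona.

Section TotalColoring.
Variable F : graph.
Implicit Types (c : element F -> nat) (k : nat) (u v : F) (x y : element F).

Definition conflict x y : bool :=
  match x, y with
  | inl u, inl v => adj u v
  | inl u, inr e => u \in val e
  | inr e, inl u => u \in val e
  | inr e, inr f => (e != f) && (val e :&: val f != set0)
  end.

Definition total_coloring k c : bool :=
  [forall x, 0 < c x <= k] && [forall x, forall y, conflict x y ==> (c x != c y)].

Definition color_product c v : nat :=
  c (inl v) * \prod_(e : edge F | v \in val e) c (inr e).

Definition product_distinguishing c : bool :=
  [forall u, forall v, adj u v ==> (color_product c u != color_product c v)].

Definition npd_total_coloring k c : bool :=
  total_coloring k c && product_distinguishing c.

(* A map into [k] is in particular a map into {0, ..., k}; this keeps the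
   quantifier over a finite type. *)
Definition npd_total_colorable k : bool :=
  [exists c : {ffun element F -> 'I_k.+1}, npd_total_coloring k (fun x => c x)].

Lemma eq_npd_total_coloring k c c' :
  c =1 c' -> npd_total_coloring k c = npd_total_coloring k c'.
Proof.
move=> cc'; have pE v : color_product c v = color_product c' v.
  by rewrite /color_product cc'; congr (_ * _); apply: eq_bigr => e _; rewrite cc'.
congr (_ && _); first congr (_ && _).
- by apply: eq_forallb => x; rewrite cc'.
- by apply: eq_forallb => x; apply: eq_forallb => y; rewrite !cc'.
- by apply: eq_forallb => u; apply: eq_forallb => v; rewrite !pE.
Qed.

Lemma npd_total_colorableP k :
  reflect (exists c, npd_total_coloring k c) (npd_total_colorable k).
Proof.
apply: (iffP existsP) => [[c cP]|[c cP]].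
  by exists (fun x => nat_of_ord (c x)).
exists [ffun x => inord (c x)].
rewrite (@eq_npd_total_coloring _ _ c) // => x.
case/andP: (cP) => /andP[/forallP/(_ x)/andP[_ cx] _] _.
by rewrite ffunE inordK.
Qed.

(* Witness for existence: color the elements with pairwise distinct primes. *)
Lemma npd_total_colorable_ex : exists k, (0 < k) && npd_total_colorable k.
Proof.
pose p := fix p n := if n is n'.+1 then s2val (prime_above (p n')) else 2.
have p_prime n : prime (p n).
  by case: n => //= n; case: (prime_above (p n)).
have p_lt m n : m < n -> p m < p n.
  elim: n => // n IHn; rewrite ltnS leq_eqVlt.
  have lt_n : p n < p n.+1 by rewrite /=; case: (prime_above (p n)).
  by case/predU1P=> [-> //|/IHn lt_mn]; apply: ltn_trans lt_n.
have p_inj : injective p.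
  by move=> m n; case: (ltngtP m n) => // /p_lt lt_mn eq_mn;
    rewrite eq_mn ltnn in lt_mn.
pose c (x : element F) := p (enum_rank x).
have c_inj : injective c by move=> x y /p_inj/ord_inj/enum_rank_inj.
have c_prime x : prime (c x) by exact: p_prime.
exists (\max_x c x).+1; apply/npd_total_colorableP; exists c.
rewrite /npd_total_coloring /total_coloring -andbA; apply/and3P; split.
- apply/forallP=> x; rewrite prime_gt0 //=.
  by apply: leqW; apply: (leq_bigmax_cond (F := c)).
- apply/forallP=> x; apply/forallP=> y; apply/implyP; apply: contraTneq => /c_inj->.
  case: y => [v|e] /=; first by rewrite adj_irr.
  by rewrite eqxx.
- apply/forallP=> u; apply/forallP=> v; apply/implyP=> uv.
  apply: contraTneq (uv) => pE.
  have: c (inl u) %| color_product c v by rewrite -pE dvdn_mulr.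
  rewrite Euclid_dvdM // dvdn_prime2 //; case/orP=> [/eqP/c_inj[->]|].
    by rewrite adj_irr.
  rewrite Euclid_dvd_prod // big_orE; case/existsP=> e /andP[_].
  by rewrite dvdn_prime2 // => /eqP/c_inj.
Qed.

Definition npd_total_chromatic_number : nat := ex_minn npd_total_colorable_ex.

End TotalColoring.

(* Main.v *)
Require Import Defs.
From mathcomp Require Import all_boot zify.
From Stdlib Require Import NArith.

Set Implicit Arguments.
Unset Strict Implicit.
Unset Printing Implicit Defensive.

(** Let [n] be the order of [H], [d] the maximum degree of [G] and [k = n + d + 3].
    A vertex of [G] has its degree in [G] plus [n] as its degree in the corona
    product, so it is enough to color the product with [k] colors.

    The coloring has two stages. First the core is colored: the vertices and edges
    of [G], and for each vertex [v] of [G] the set of the [n] colors of the edges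
    from [v] to its copy of [H] ([core_coloring]). This fixes the products at the
    vertices of [G]. Then each copy is colored on its own, given the color [a] and
    the product [P] of its vertex [v] and the colors [p u] of the edges from [v]
    ([copy_coloring], [corona_colorable]). Both stages are mostly greedy: when all
    colors at a vertex but one are fixed, its product determines the last one, so
    that a neighbor with a known product excludes one value of it.

    Plain counting colors the copies when [k >= 13] ([copy_colorable_plain]). For
    smaller [k] the number of neighbors to compare with is reduced by a largest cut:
    in a subcubic graph it leaves each vertex at most one neighbor on its own side.
    If a prime [q] with [k < 2q] is a color at every vertex of one side and at no
    vertex of the other one, products across the cut differ, since [q] is the only
    color that it divides. With [q = 7], kept out of the core by [core_avoiding],
    this settles [10 <= k <= 12], and also [n = d = 3]
    ([copy_colorable_marked]). The same device colors the core when [d = 3] and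
    [n <= 2], where there is little choice for the colors of the edges towards the
    copies ([core_of_cut]).

    What is left is [d <= 2] and [n + d <= 6]. There the core is colored from short
    lists ([core_of_lists]), which leaves finitely many data [a], [p], [P] for a copy
    with at most six vertices, and a computation finds a coloring for all subcubic
    graphs and all such data ([copy_colorable_check], [small_check_all]). *)

(** * Total colorings given by two functions *)

Section FunColoring.
Variable F : graph.
Implicit Types (x : F -> nat) (e : F -> F -> nat) (u v w : F).

Definition vertex_product x e v := x v * \prod_(w | adj v w) e v w.

Record proper_pair k x e : Prop := ProperPair {
  vcol_range : forall v, 0 < x v <= k;
  ecol_range : forall u v, adj u v -> 0 < e u v <= k;
  ecol_sym : forall u v, e u v = e v u;
  vcol_adj : forall u v, adj u v -> x u != x v;
  vcol_ecol : forall u v, adj u v -> e u v != x u;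
  ecol_adj : forall u v w, adj u v -> adj u w -> v != w -> e u v != e u w }.

Lemma adj_neq u v : adj u v -> u != v.
Proof. by apply: contraTneq => ->; rewrite adj_irr. Qed.

Lemma edgesP (s : {set F}) :
  reflect (exists u v, adj u v /\ s = [set u; v]) (s \in edges F).
Proof.
rewrite inE; apply: (iffP existsP) => [[u /existsP[v /andP[uv /eqP->]]]|].
  by exists u, v.
by move=> [u [v [uv ->]]]; exists u; apply/existsP; exists v; rewrite uv eqxx.
Qed.

Lemma set2_edges u v : adj u v -> [set u; v] \in edges F.
Proof. by move=> uv; apply/edgesP; exists u, v. Qed.

Lemma edge_at u (s : {set F}) :
  s \in edges F -> u \in s -> exists2 v, adj u v & s = [set u; v].
Proof.
case/edgesP=> a [b [ab ->]]; rewrite !inE => /orP[]/eqP->; first by exists b.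
by exists a; rewrite 1?adj_sym // setUC.
Qed.

Lemma set2_inj u v w : [set u; v] = [set u; w] -> v = w.
Proof.
move=> E; have := set22 u v; rewrite E !inE => /orP[]/eqP // vu.
by have := set22 u w; rewrite -E !inE vu orbb => /eqP.
Qed.

(** An edge is a set without distinguished endpoints: a symmetric function gives
    it the color of an arbitrary ordering of its two ends. *)
Definition set_color e (s : {set F}) : nat :=
  if [pick a : F * F | adj a.1 a.2 && (s == [set a.1; a.2])] is Some a
  then e a.1 a.2 else 0.

Lemma set_colorE e u v : (forall u v, e u v = e v u) -> adj u v ->
  set_color e [set u; v] = e u v.
Proof.
move=> e_sym uv; rewrite /set_color; case: pickP => [[a b] /= /andP[ab /eqP E]|].
  have := set21 u v; rewrite E !inE => /orP[]/eqP Eu; subst.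
    by rewrite (set2_inj E).
  by move: E; rewrite [X in _ = X]setUC => /set2_inj ->.
by move=> /(_ (u, v)); rewrite /= uv eqxx.
Qed.

(** Colorings are handled below as two functions on vertices, which avoids the
    type of edges; this is the only link with total colorings. *)
Lemma npd_colorable_of_fun k x e : proper_pair k x e ->
  (forall u v, adj u v -> vertex_product x e u != vertex_product x e v) ->
  npd_total_colorable F k.
Proof.
move=> [x_range e_range e_sym x_adj x_e e_adj] dist.
pose c (y : element F) :=
  match y with inl v => x v | inr s => set_color e (val s) end.
have prodE v : color_product c v = vertex_product x e v.
  rewrite /color_product /vertex_product; congr (_ * _); rewrite /c.
  transitivity (\prod_(s in [set [set v; w] | w in [set w | adj v w]])
      set_color e s); last first.
    rewrite big_imset /=; last by move=> w w' _ _ /set2_inj.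
    by apply: eq_big => [w|w]; rewrite !inE // => /(set_colorE e_sym).
  rewrite (eq_bigl (fun s => (s \in edges F) && (v \in s))); last first.
    move=> s; apply/imsetP/andP => [[w]|[sE vs]].
      by rewrite inE => vw ->; rewrite set2_edges // set21.
    by have [w vw ->] := edge_at sE vs; exists w; rewrite ?inE.
  by rewrite (big_sub_cond (edges F) (fun s : {set F} => v \in s)).
apply/npd_total_colorableP; exists c; apply/andP; split; last first.
  apply/forallP=> u; apply/forallP=> v; apply/implyP=> uv.
  by rewrite !prodE dist.
have cE u v (s : edge F) : adj u v -> val s = [set u; v] -> c (inr s) = e u v.
  by move=> uv /= ->; rewrite set_colorE.
have vx u (s : edge F) : u \in val s -> c (inl u) != c (inr s).
  by move=> /(edge_at (valP s))[v uv /(cE _ _ _ uv)->]; rewrite eq_sym x_e.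
apply/andP; split.
  apply/forallP=> -[v|s]; first exact: x_range.
  by have /edgesP[u [v [uv /(cE _ _ _ uv)->]]] := valP s; apply: e_range.
apply/forallP=> -[u|s]; apply/forallP=> -[v|t]; apply/implyP => //=.
- exact: x_adj.
- exact: vx.
- by rewrite eq_sym; apply: vx.
case/andP=> st /set0Pn[u]; rewrite inE => /andP[us ut].
have [v uv sE] := edge_at (valP s) us; have [w uw tE] := edge_at (valP t) ut.
rewrite -[set_color e _]/(c (inr s)) -[set_color e (val t)]/(c (inr t)).
rewrite (cE _ _ _ uv sE) (cE _ _ _ uw tE) e_adj //.
by apply: contraNneq st => vw; apply/eqP/val_inj; rewrite sE tE vw.
Qed.

End FunColoring.

(** * Greedy choice *)

(** Each [i] in [r] excludes some of the colors in [s]; colors excluded several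
    times are counted several times, so the bound needs no disjointness. *)
Lemma has_unexcluded (I : Type) (r : seq I) (p : I -> pred nat) (s : seq nat) :
  \sum_(i <- r) count (p i) s < size s -> exists2 c, c \in s & ~~ has (p^~ c) r.
Proof.
move=> lt_s; have : ~~ all (fun c => has (p^~ c) r) s.
  rewrite all_count neq_ltn; apply/orP; left; apply: leq_ltn_trans lt_s.
  elim: r => [|i r IHr] /=; first by rewrite count_pred0 big_nil.
  rewrite big_cons; apply: leq_trans (leq_add (leqnn _) IHr).
  by rewrite -count_predUI leq_addr.
by case/allPn=> c cs cr; exists c.
Qed.

(** Elements are treated one at a time, in any order: those already treated exclude
    in all fewer colors than are available. The relation [bad] says that two
    colored elements are in conflict, and [m v w] bounds the number of colors that
    one color of [w] excludes at [v]. *)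
Lemma greedy (T : finType) (avail : T -> seq nat)
    (bad : T -> nat -> T -> nat -> bool) (m : T -> T -> nat) :
  (forall v c w d, bad v c w d = bad w d v c) ->
  (forall v w d, w != v -> count (fun c => bad v c w d) (avail v) <= m v w) ->
  (forall v, \sum_(w | w != v) m v w < size (avail v)) ->
  exists f : T -> nat, (forall v, f v \in avail v) /\
    (forall v w, v != w -> ~~ bad v (f v) w (f w)).
Proof.
move=> bad_sym bad_m m_lt.
suff /(_ (enum T) (enum_uniq T)) [f [f1 f2]] : forall s, uniq s ->
    exists f : T -> nat, (forall v, v \in s -> f v \in avail v) /\
    {in s &, forall v w, v != w -> ~~ bad v (f v) w (f w)}.
  by exists f; split=> [v|v w]; [apply: f1|apply: f2]; rewrite mem_enum.
elim=> [_|v s IHs /= /andP[vs us]]; first by exists (fun=> 0).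
have [f [fa fb]] := IHs us.
have [|c cv cs] := @has_unexcluded _ s (fun w c => bad v c w (f w)) (avail v).
  apply: leq_ltn_trans (m_lt v).
  apply: (@leq_trans (\sum_(w <- s) m v w)).
    rewrite !big_seq; apply: leq_sum => w ws; apply: bad_m.
    by apply: contraNneq vs => <-.
  rewrite big_uniq // [leqRHS](bigID (mem s)) /=.
  rewrite (eq_bigl (fun w => (w != v) && (w \in s))) ?leq_addr // => w.
  by case: eqP => [->|] //=; rewrite (negPf vs).
exists (fun w => if w == v then c else f w); split=> [w|w1 w2].
  by rewrite inE; case: eqP => [-> //|_]; apply: fa.
rewrite !inE; case: (w1 =P v) => [->|w1v] /=; case: (w2 =P v) => [->|w2v] /=.
- by rewrite eqxx.
- by move=> _ w2s _; apply: (hasPn cs).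
- by move=> w1s _ _; rewrite bad_sym; apply: (hasPn cs).
- exact: fb.
Qed.

Lemma count_eq1 (s : seq nat) (p : pred nat) : uniq s ->
  {in s &, forall c d, p c -> p d -> c = d} -> count p s <= 1.
Proof.
move=> us inj; rewrite -size_filter.
have : {in filter p s &, forall c d, c = d}.
  by move=> c d; rewrite !mem_filter => /andP[pc cs] /andP[pd ds]; apply: inj.
have := filter_uniq p us; case: (filter p s) => [|c [|d t]] //= + E.
by rewrite (E c d) ?inE ?eqxx ?orbT.
Qed.

Definition avoid (s forb : seq nat) : seq nat := [seq c <- s | c \notin forb].

Lemma mem_avoid s f c : (c \in avoid s f) = (c \notin f) && (c \in s).
Proof. exact: mem_filter. Qed.

Lemma size_avoid (s f : seq nat) : uniq s -> size s - size f <= size (avoid s f).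
Proof.
move=> us; rewrite leq_subLR size_filter -(count_predC (mem f) s) leq_add2r.
rewrite -size_filter; apply: uniq_leq_size; first exact: filter_uniq.
by move=> c; rewrite mem_filter => /andP[].
Qed.

Lemma avoid_uniq s f : uniq s -> uniq (avoid s f).
Proof. exact: filter_uniq. Qed.

(** * Greedy edge colorings *)

Section Graph.
Variable F : graph.
Implicit Types (u v w : F).

Lemma degree_max v : degree v <= max_degree F.
Proof. exact: leq_bigmax. Qed.

Lemma degreeE v : degree v = \sum_(w | adj v w) 1.
Proof. by rewrite sum1_card /degree cardsE. Qed.

Definition nbrs v : seq F := [seq w <- enum F | adj v w].

Lemma nbrs_uniq v : uniq (nbrs v).
Proof. by rewrite filter_uniq ?enum_uniq. Qed.

Lemma mem_nbrs v w : (w \in nbrs v) = adj v w.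
Proof. by rewrite mem_filter mem_enum andbT. Qed.

Lemma size_nbrs v : size (nbrs v) = degree v.
Proof.
rewrite /degree cardE; apply: perm_size; apply: uniq_perm; first exact: nbrs_uniq.
  exact: enum_uniq.
by move=> w; rewrite mem_nbrs mem_enum inE.
Qed.

Lemma adjacent_edges h u v : (forall w, degree w <= h) -> adj u v ->
  #|[set t in edges F | (t != [set u; v]) && ([set u; v] :&: t != set0)]|
    <= 2 * h - 2.
Proof.
move=> deg_h uv.
pose star (a b : F) := [set [set a; w] | w in [set w | adj a w] :\ b].
have star_h a b : adj a b -> #|star a b| <= h.-1.
  move=> ab; apply: leq_trans (leq_imset_card _ _) _.
  by have := deg_h a; rewrite /degree (cardsD1 b) inE ab; case: (h).
apply: (@leq_trans #|star u v :|: star v u|); last first.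
  apply: leq_trans (leq_card_setU _ _) _.
  apply: leq_trans (leq_add (star_h _ _ uv) (star_h v u _)) _; rewrite 1?adj_sym //.
  by case: (h) => // n; lia.
apply/subset_leq_card/subsetP => t; rewrite in_set in_setU => /and3P[tE tuv /set0Pn[a]].
rewrite !inE => /andP[/orP[]/eqP-> at_].
  have [w uw tD] := edge_at tE at_; apply/orP; left; apply/imsetP; exists w => //.
  by rewrite !inE uw andbT; apply: contraNneq tuv => wv; rewrite tD wv.
have [w vw tD] := edge_at tE at_; apply/orP; right; apply/imsetP; exists w => //.
by rewrite !inE vw andbT; apply: contraNneq tuv => wv; rewrite tD wv setUC.
Qed.

(** Greedy coloring of the edges with palette [pal], where the edges at [v] also
    avoid the colors [forb v]: an edge meets at most [2h - 2] others, and its two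
    ends forbid at most [b] colors each. *)
Lemma greedy_edges h b (pal : seq nat) (forb : F -> seq nat) :
  uniq pal -> (forall v, degree v <= h) -> (forall v, size (forb v) <= b) ->
  2 * b + (2 * h - 2) < size pal ->
  exists e : F -> F -> nat,
    [/\ forall u v, e u v = e v u,
        forall u v, adj u v -> e u v \in avoid pal (forb u)
      & forall u v w, adj u v -> adj u w -> v != w -> e u v != e u w].
Proof.
move=> pal_uniq deg_h forb_b pal_big.
pose meets (s t : {set F}) :=
  [&& s \in edges F, t \in edges F, t != s & s :&: t != set0].
pose avail (s : {set F}) :=
  if s \in edges F then avoid pal (flatten [seq forb v | v in s]) else pal.
have [||s|f [f_avail f_ok]] := @greedy _ avail
    (fun s c t d => meets s t && (c == d)) (fun s t => meets s t).
- move=> s c t d; rewrite (eq_sym c); congr (_ && _).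
  by rewrite /meets (eq_sym t) setIC; case: (s \in _); rewrite ?andbF.
- move=> s t d _; case: (meets s t) => /=; last by rewrite count_pred0.
  apply: count_eq1 => [|c c' _ _ /eqP-> /eqP-> //].
  by rewrite /avail; case: ifP; rewrite ?avoid_uniq.
- rewrite /avail; case: ifPn => [sE|sE]; last first.
    by rewrite big1 => [|t _]; rewrite /meets ?(negPf sE) //; lia.
  apply: leq_ltn_trans (_ : 2 * h - 2 < _).
    have /edgesP[u [v [uv sD]]] := sE; rewrite sD.
    apply: leq_trans (adjacent_edges deg_h uv); rewrite -sum1_card big_mkcond.
    rewrite [leqRHS]big_mkcond; apply: leq_sum => t _; rewrite inE /meets.
    by rewrite -sD sE /=; case: (t \in _); case: (t != s); case: (_ != set0).
  apply: leq_trans (size_avoid _ pal_uniq).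
  suff forb_b2 : size (flatten [seq forb v | v in s]) <= 2 * b.
    by apply: leq_trans (leq_sub2l _ forb_b2); lia.
  have /edgesP[u [v [uv sD]]] := sE.
  have <- : #|s| = 2 by rewrite sD cards2 adj_neq.
  rewrite size_flatten /shape -map_comp sumnE big_map cardE.
  elim: (enum _) => [|w r IHr]; rewrite ?big_nil // big_cons /= mulSn.
  by rewrite leq_add.
exists (fun u v => f [set u; v]); split=> [u v|u v uv|u v w uv uw vw].
- by rewrite setUC.
- have := f_avail [set u; v]; rewrite /avail set2_edges // !mem_avoid.
  case/andP=> + ->; rewrite andbT; apply: contra => fu.
  by apply/flattenP; exists (forb u) => //; apply/imageP; exists u; rewrite ?set21.
have st : [set u; w] != [set u; v] by apply: contraNneq vw => /set2_inj ->.
have := f_ok [set u; v] [set u; w]; rewrite eq_sym => /(_ st).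
rewrite /meets !set2_edges // st /=; case: (_ =P set0) => //= /setP/(_ u).
by rewrite !inE eqxx.
Qed.

(** * Large cuts *)

Definition side_degree (A : {set F}) v (b : bool) :=
  \sum_(w | adj v w) (((w \in A) != (v \in A)) == b : nat).

(** In a cut with the largest number of edges, moving one vertex to the other side
    gains nothing. *)
Lemma max_cut : exists A : {set F},
  forall v, side_degree A v false <= side_degree A v true.
Proof.
pose cut (A : {set F}) := \sum_v side_degree A v true.
have [A _ Amax] := @arg_maxnP _ set0 xpredT cut isT.
exists A => v; have := Amax (if v \in A then A :\ v else v |: A) isT.
set B := (if _ then _ else _).
have Bv : (v \in B) = (v \notin A).
  by rewrite /B; case: ifP => vA; rewrite !inE eqxx.
have Bw w : w != v -> (w \in B) = (w \in A).
  by move=> wv; rewrite /B; case: ifP => _; rewrite !inE (negPf wv).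
clearbody B.
pose cross (C : {set F}) u := (adj u v && ((v \in C) != (u \in C)) : nat).
pose rest (C : {set F}) u :=
  \sum_(w | adj u w && (w != v)) ((w \in C) != (u \in C) : nat).
have side_degreeE C u : u != v -> side_degree C u true = cross C u + rest C u.
  move=> uv; rewrite /side_degree /rest /cross; case: (boolP (adj u v)) => auv /=.
    by rewrite (bigD1 v) //=; congr (_ + _); [|apply: eq_bigr => w _]; rewrite eqb_id.
  rewrite add0n; apply: eq_big => [w|w _]; last by rewrite eqb_id.
  by case: (w =P v) => [->|]; rewrite ?andbT // (negPf auv).
have cutE C : cut C =
    side_degree C v true + (side_degree C v true + \sum_(u | u != v) rest C u).
  rewrite /cut (bigD1 v) //=; congr (_ + _).
  rewrite (eq_bigr _ (side_degreeE C)) big_split /=; congr (_ + _).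
  rewrite /side_degree [RHS]big_mkcond /= [RHS](bigD1 v) //= adj_irr add0n.
  apply: eq_bigr => u uv; rewrite /cross adj_sym; case: adj => //=.
  by rewrite eqb_id eq_sym.
have -> : side_degree A v false = side_degree B v true.
  apply: eq_bigr => w vw; rewrite Bv Bw; last by rewrite eq_sym adj_neq.
  by case: (w \in A); case: (v \in A).
rewrite !cutE; suff -> : \sum_(u | u != v) rest B u = \sum_(u | u != v) rest A u.
  lia.
apply: eq_bigr => u uv; apply: eq_bigr => w /andP[_ wv].
by rewrite !Bw.
Qed.

Definition same_side (A : {set F}) : rel F :=
  fun u v => adj u v && ((u \in A) == (v \in A)).

Lemma same_side_sym A : symmetric (same_side A).
Proof. by move=> u v; rewrite /same_side adj_sym eq_sym. Qed.

Lemma same_side_irr A v : ~~ same_side A v v.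
Proof. by rewrite /same_side adj_irr. Qed.

(** Out of at most three neighbors, at least half lie across a largest cut, so at
    most one lies on the same side. *)
Lemma subcubic_cut : subcubic F -> exists A : {set F}, forall u v w,
  same_side A u v -> same_side A u w -> v = w.
Proof.
move=> F3; have [A Acut] := max_cut.
exists A => u v w /andP[uv /eqP vA] /andP[uw /eqP wA].
apply: contraTeq (Acut u) => vw; rewrite -ltnNge.
have := leq_trans (degree_max u) F3; rewrite degreeE.
have -> : \sum_(w | adj u w) 1 = side_degree A u true + side_degree A u false.
  by rewrite -big_split; apply: eq_bigr => t _ /=; case: (_ != _).
suff : 1 < side_degree A u false by lia.
rewrite /side_degree (bigD1 v) // (bigD1 w) /=; last by rewrite uw eq_sym.
by rewrite -vA -wA eqxx /=; lia.
Qed.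

Lemma card_same_side A v :
  (forall u v w, same_side A u v -> same_side A u w -> v = w) ->
  #|[set w | same_side A v w]| <= 1.
Proof.
by move=> A1; apply/card_le1_eqP => u w; rewrite !inE => vu vw; apply: A1 vw vu.
Qed.

End Graph.

(** * Colors that differ at related vertices *)

Section Separate.
Variable F : graph.
Implicit Types (u v w : F).

Lemma count_rel_uniq (E : rel F) u : (forall v, ~~ E v v) ->
  \sum_(w | w != u) (E u w : nat) = #|[set w | E u w]|.
Proof.
move=> E_irr; rewrite -sum1_card big_mkcond [RHS]big_mkcond.
apply: eq_bigr => w _; rewrite inE; case: (w =P u) => [->|_] /=.
  by rewrite (negPf (E_irr u)).
by case: (E u w).
Qed.

(** Vertices related by [E] get different values [val v (f v)]; as [val v] is
    injective, one neighbor excludes one color. *)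
Lemma greedy_values (E : rel F) (avail : F -> seq nat) (val : F -> nat -> nat) :
  symmetric E -> (forall v, ~~ E v v) -> (forall v, uniq (avail v)) ->
  (forall v, {in avail v &, injective (val v)}) ->
  (forall v, #|[set w | E v w]| < size (avail v)) ->
  exists f, (forall v, f v \in avail v) /\
    (forall v w, E v w -> val v (f v) != val w (f w)).
Proof.
move=> E_sym E_irr av_uniq val_inj E_small.
have [||v|f [f_av f_ok]] := @greedy _ avail
    (fun v c w d => E v w && (val v c == val w d)) (fun v w => E v w).
- by move=> v c w d; rewrite E_sym eq_sym.
- move=> v w d _; case: (E v w) => /=; last by rewrite count_pred0.
  apply: count_eq1 => // c c' cs c's /eqP<- /eqP cc'.
  exact: (val_inj v).
- by rewrite count_rel_uniq.
exists f; split=> // v w Evw; have := f_ok v w; rewrite Evw; apply.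
by apply: contraTneq Evw => ->.
Qed.

(** Here [M v] is the product of the colors of the edges at [v], and both the
    colors and the total products must differ: one neighbor excludes two colors. *)
Lemma greedy_separated (E : rel F) (avail : F -> seq nat) (M : F -> nat) :
  symmetric E -> (forall v, ~~ E v v) -> (forall v, uniq (avail v)) ->
  (forall v, 0 < M v) ->
  (forall v, 2 * #|[set w | E v w]| < size (avail v)) ->
  exists f, (forall v, f v \in avail v) /\
    (forall v w, E v w -> f v != f w /\ f v * M v != f w * M w).
Proof.
move=> E_sym E_irr av_uniq M_gt0 E_small.
have [||v|f [f_av f_ok]] := @greedy _ avail
    (fun v c w d => E v w && ((c == d) || (c * M v == d * M w)))
    (fun v w => 2 * E v w).
- by move=> v c w d; rewrite E_sym eq_sym [_ * _ == _]eq_sym.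
- move=> v w d _; case: (E v w) => /=; last by rewrite count_pred0.
  apply: (@leq_trans (count (pred1 d) (avail v)
                      + count (fun c => c * M v == d * M w) (avail v))).
    by rewrite -count_predUI; apply: leq_trans (leq_addr _ _).
  rewrite (leq_add (n1 := 1) (n2 := 1)) //.
    by apply: count_eq1 => // c c' _ _ /eqP-> /eqP->.
  apply: count_eq1 => // c c' _ _ /eqP<- /eqP/eqP.
  by rewrite eqn_pmul2r // => /eqP.
- by rewrite -big_distrr /= count_rel_uniq.
exists f; split=> // v w Evw; have := f_ok v w.
rewrite Evw /= negb_or; case/(_ _)/andP=> //.
by apply: contraTneq Evw => ->.
Qed.

Lemma prod_gt0 (I : Type) (r : seq I) (P : pred I) (f : I -> nat) :
  (forall i, P i -> 0 < f i) -> 0 < \prod_(i <- r | P i) f i.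
Proof. by move=> f_gt0; elim/big_ind: _ => // m p m0 p0; rewrite muln_gt0 m0. Qed.

Lemma vertex_product_gt0 k x e v : proper_pair k x e -> 0 < vertex_product x e v.
Proof.
move=> xe; rewrite muln_gt0; have /andP[-> _] := vcol_range xe v.
by apply: prod_gt0 => w /(ecol_range xe)/andP[].
Qed.

Lemma ndvd_small q c : 0 < c < 2 * q -> c != q -> ~~ (q %| c).
Proof.
move=> c_range cq; apply/dvdnP => -[[|[|m]] cE]; rewrite cE in c_range cq.
- by move: c_range; rewrite mul0n.
- by rewrite mul1n eqxx in cq.
- by move: c_range; rewrite ltn_mul2r; case: q {cq cE} => // q; lia.
Qed.

Lemma ndvd_prod (I : Type) (r : seq I) (P : pred I) (f : I -> nat) q : prime q ->
  (forall i, P i -> ~~ (q %| f i)) -> ~~ (q %| \prod_(i <- r | P i) f i).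
Proof.
move=> q_pr q_f; elim/big_ind: _ => //; first by rewrite dvdn1 neq_ltn prime_gt1 ?orbT.
by move=> m p qm qp; rewrite Euclid_dvdM // negb_or qm.
Qed.

Lemma vertex_product_ndvd q x e v : prime q -> ~~ (q %| x v) ->
  (forall w, adj v w -> ~~ (q %| e v w)) -> ~~ (q %| vertex_product x e v).
Proof.
by move=> q_pr qx qe; rewrite Euclid_dvdM // negb_or qx ndvd_prod.
Qed.

End Separate.

(** * Coloring the base graph *)

Section Core.
Variable G : graph.
Implicit Types (u v w : G) (a : G -> nat) (g : G -> G -> nat) (S : G -> seq nat).

(** [S v] lists the colors of the edges that join [v] to its copy of the second
    factor. Which edge gets which of these colors does not affect the product at
    [v], so it can be decided later. *)
Definition core_product a g S v := vertex_product a g v * \prod_(c <- S v) c.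

Record core_coloring k a g S : Prop := CoreColoring {
  core_pair : proper_pair k a g;
  pend_uniq : forall v, uniq (S v);
  pend_range : forall v, {in S v, forall c, 0 < c <= k};
  pend_vcol : forall v, a v \notin S v;
  pend_ecol : forall u v, adj u v -> g u v \notin S u;
  core_dist : forall u v, adj u v -> core_product a g S u != core_product a g S v }.

(** New colors used on a new edge at every vertex multiply all the products by the
    same number, so it is enough to treat few pendant edges. *)
Lemma core_extend k m a g S : core_coloring k a g S ->
  core_coloring (k + m) a g (fun v => S v ++ iota k.+1 m).
Proof.
move=> [[x1 e1 e2 x2 xe e3] S1 S2 S3 S4 dist].
have up c : 0 < c <= k -> 0 < c <= k + m by lia.
have new c : 0 < c <= k -> c \notin iota k.+1 m by rewrite mem_iota; lia.
split=> [|v|v c|v|u v uv|u v uv].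
- by split=> // [v|u v uv]; apply: up; [apply: x1|apply: e1].
- rewrite cat_uniq S1 iota_uniq andbT /=; apply/hasPn=> c cr /=.
  by apply: contraL cr => /S2; apply: new.
- by rewrite mem_cat => /orP[/S2/up//|]; rewrite mem_iota; lia.
- by rewrite mem_cat negb_or S3 new.
- by rewrite mem_cat negb_or S4 // new // e1.
- rewrite /core_product !big_cat /= !mulnA eqn_pmul2r; first exact: dist.
  by rewrite big_seq; apply: prod_gt0 => c; rewrite mem_iota; lia.
Qed.

Lemma core_product1 a g (s : G -> nat) v :
  core_product a g (fun w => [:: s w]) v = vertex_product a g v * s v.
Proof. by rewrite /core_product big_seq1. Qed.

Definition ecols g v := [seq g v w | w <- nbrs v].

Lemma mem_ecols g v w : adj v w -> g v w \in ecols g v.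
Proof. by move=> vw; apply/mapP; exists w; rewrite ?mem_nbrs. Qed.

Lemma size_ecols g v : size (ecols g v) = degree v.
Proof. by rewrite size_map size_nbrs. Qed.

(** One pendant edge per vertex, with vertex colors in [X], edge colors in [Y] and
    pendant colors in [T]. The pendant color is chosen last: at least
    [2d + 1 - degree v] colors of [T] remain for it, and the neighbors exclude at
    most [degree v <= d] of them. *)
Lemma core_of_lists d k (X Y T : seq nat) : max_degree G <= d ->
  uniq X -> uniq Y -> uniq T -> {in X ++ Y ++ T, forall c, 0 < c <= k} ->
  d < size X -> 2 * d - 2 < size Y -> {in X, forall c, c \notin Y} ->
  {in X, forall c, 2 * d < size (avoid T [:: c])} ->
  exists a g s, [/\ core_coloring k a g (fun v => [:: s v]),
    forall v, a v \in X, forall u v, adj u v -> g u v \in Y & forall v, s v \in T].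
Proof.
move=> Gd uX uY uT XYT_range X_big Y_big XY T_big.
have deg_d v : degree v <= d := leq_trans (degree_max v) Gd.
have [g [g_sym gY g_adj]] :=
  @greedy_edges G d 0 Y (fun=> [::]) uY deg_d (fun=> isT) Y_big.
have {}gY u v : adj u v -> g u v \in Y.
  by move=> /gY; rewrite mem_avoid => /andP[].
have adj_irr' v : ~~ adj v v by rewrite adj_irr.
have [||v c c'|v|a [aX a_adj]] :=
    @greedy_values G (@adj G) (fun=> X) (fun _ c => c) _ adj_irr'; try by [].
- exact: adj_sym.
- by apply: leq_ltn_trans X_big; apply: deg_d.
have aG : proper_pair k a g.
  split=> // [v|u v uv|u v uv].
  - by apply: XYT_range; rewrite mem_cat aX.
  - by apply: XYT_range; rewrite !mem_cat gY ?orbT.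
  - by apply: contraNneq (XY _ (aX u)) => <-; apply: gY.
pose avail v := avoid (avoid T [:: a v]) (ecols g v).
have [|v|v c c' _ _|v|s [s_av s_adj]] :=
    @greedy_values G (@adj G) avail (fun v c => vertex_product a g v * c) _ adj_irr'.
- exact: adj_sym.
- by rewrite !avoid_uniq.
- by move=> /eqP; rewrite eqn_pmul2l ?(vertex_product_gt0 v aG) // => /eqP.
- apply: leq_trans (size_avoid _ (avoid_uniq _ uT)); rewrite size_ecols.
  apply: leq_ltn_trans (deg_d v) _.
  rewrite ltn_subRL; apply: leq_ltn_trans (T_big _ (aX v)).
  by rewrite mul2n -addnn leq_add2r deg_d.
have sP v : [/\ s v \in T, s v != a v & s v \notin ecols g v].
  by have := s_av v; rewrite !mem_avoid inE => /and3P[].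
exists a, g, s; split=> // [|v]; last by case: (sP v).
split=> // [v c|v|u v uv|u v uv].
- rewrite inE => /eqP->; apply: XYT_range; rewrite !mem_cat.
  by case: (sP v) => ->; rewrite !orbT.
- by rewrite inE eq_sym; case: (sP v).
- by rewrite inE; have [_ _] := sP u; apply: contraNneq => <-; apply: mem_ecols.
- by rewrite !core_product1; apply: s_adj.
Qed.

(** With [n] pendant edges per vertex, the color [q] can be kept out altogether. The
    [n.+1] colors of [W v] are free at [v], and [S v] leaves out one of them, [y v].
    The choice of [y v] determines the product at [v], and at most [d <= n] choices
    are excluded. *)
Lemma core_avoiding q n d k : max_degree G <= d -> d <= n -> k = n + d + 3 ->
  0 < q <= k -> exists a g S,
  [/\ core_coloring k a g S, forall v, size (S v) = n, forall v, a v != q,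
    forall u v, adj u v -> g u v != q & forall v, q \notin S v].
Proof.
move=> Gd dn kE q_range.
have deg_d v : degree v <= d := leq_trans (degree_max v) Gd.
pose pal := rem q (iota 1 k).
have pal_uniq : uniq pal by rewrite rem_uniq ?iota_uniq.
have mem_pal c : (c \in pal) = (c != q) && (0 < c <= k).
  by rewrite mem_rem_uniq ?iota_uniq // inE /= mem_iota add1n.
have pal_size : size pal = n + d + 2.
  by rewrite size_rem ?size_iota ?mem_iota ?add1n // kE; lia.
have [||||g [g_sym g_pal g_adj]] := @greedy_edges G d 0 pal (fun=> [::]) => //.
  by rewrite pal_size; lia.
have {}g_pal u v : adj u v -> g u v \in pal.
  by move=> /g_pal; rewrite mem_avoid => /andP[].
have adj_irr' v : ~~ adj v v by rewrite adj_irr.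
have [||v c c'|v|a [a_av a_adj]] := @greedy_values G (@adj G)
    (fun v => avoid pal (ecols g v)) (fun _ c => c) _ adj_irr'; try by [].
- exact: adj_sym.
- by move=> v; rewrite avoid_uniq.
- apply: leq_trans (size_avoid _ pal_uniq); rewrite size_ecols pal_size.
  by apply: leq_ltn_trans (deg_d v) _; have := deg_d v; lia.
have aP v : a v \in pal /\ a v \notin ecols g v.
  by have := a_av v; rewrite mem_avoid => /andP[].
have aG : proper_pair k a g.
  split=> // [v|u v uv|u v uv].
  - by have [+ _] := aP v; rewrite mem_pal => /andP[].
  - by have := g_pal u v uv; rewrite mem_pal => /andP[].
  - by have [_] := aP u; apply: contraNneq => <-; apply: mem_ecols.
pose W v := take n.+1 (avoid pal (a v :: ecols g v)).
have W_uniq v : uniq (W v) by rewrite take_uniq ?avoid_uniq.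
have W_size v : size (W v) = n.+1.
  rewrite size_takel //; apply: leq_trans (size_avoid _ pal_uniq).
  by rewrite /= size_ecols pal_size; have := deg_d v; lia.
have W_sub v c : c \in W v -> [/\ c \in pal, c != a v & c \notin ecols g v].
  by move=> /mem_take; rewrite mem_avoid inE negb_or => /andP[/andP[]].
have W_gt0 v : 0 < \prod_(c <- W v) c.
  rewrite big_seq; apply: prod_gt0 => c /W_sub[+ _ _].
  by rewrite mem_pal => /and3P[].
pose S (y : G -> nat) v := rem (y v) (W v).
pose Pr v y := vertex_product a g v * \prod_(c <- rem y (W v)) c.
have W_rem v y : y \in W v -> \prod_(c <- W v) c = y * \prod_(c <- rem y (W v)) c.
  by move=> yW; rewrite (perm_big _ (perm_to_rem yW)) big_cons.
have [||v c c' cW c'W|v|y [yW y_adj]] := @greedy_values G (@adj G) W Pr _ adj_irr' => //.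
- exact: adj_sym.
- move=> /eqP; rewrite eqn_pmul2l ?(vertex_product_gt0 v aG) // => /eqP eq_rem.
  have := W_rem v c cW; rewrite (W_rem v c' c'W) eq_rem => /eqP.
  rewrite eqn_pmul2r; first by move/eqP.
  by have := W_gt0 v; rewrite (W_rem v c' c'W) muln_gt0 => /andP[].
- by rewrite W_size ltnS; apply: leq_trans dn; apply: deg_d.
have S_sub v c : c \in S y v -> [/\ c \in pal, c != a v & c \notin ecols g v].
  by move=> /mem_rem; apply: W_sub.
exists a, g, (S y); split=> [|v|v|u v uv|v].
- split=> // [v|v c|v|u v uv].
  + exact: rem_uniq.
  + by case/S_sub; rewrite mem_pal => /andP[].
  + by apply/negP => /S_sub[_]; rewrite eqxx.
  + by apply/negP => /S_sub[_ _]; rewrite mem_ecols.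
- by rewrite size_rem // W_size.
- by have [+ _] := aP v; rewrite mem_pal => /andP[].
- by have := g_pal u v uv; rewrite mem_pal => /andP[].
- by apply/negP => /S_sub[+ _ _]; rewrite mem_pal eqxx.
Qed.

End Core.

Section CoreCut.
Variable G : graph.
Implicit Types (u v w : G).

(** Seven colors leave little freedom. The edges use the colors 1 to 6, so at least
    three of these six remain at each vertex. The color 7 marks the vertices of one side [A]
    of a largest cut: it is the vertex color or the pendant color of each of them,
    and is absent on the other side. Being the only multiple of the prime 7, it
    makes products across the cut differ, and one neighbor per vertex remains. *)
Lemma core_of_cut : subcubic G ->
  exists a g s, core_coloring 7 (G := G) a g (fun v => [:: s v]).
Proof.
move=> G3; have deg3 v : degree v <= 3 := leq_trans (degree_max v) G3.
have [A A1] := subcubic_cut G3.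
have cardA v := card_same_side v A1.
have mateS := same_side_sym A; have mateI := @same_side_irr _ A.
have [||||g [g_sym gP g_adj]] := @greedy_edges G 3 0 (iota 1 6) (fun=> [::]) => //.
have {}gP u v : adj u v -> 0 < g u v < 7.
  by move=> /gP; rewrite mem_avoid mem_iota => /andP[].
pose R v := avoid (iota 1 6) (ecols g v).
have R_uniq v : uniq (R v) by rewrite avoid_uniq ?iota_uniq.
have R_size v : 2 < size (R v).
  apply: leq_trans (size_avoid _ (iota_uniq _ _)).
  by rewrite size_ecols size_iota; have := deg3 v; lia.
have RP v c : c \in R v -> 0 < c < 7 /\ c \notin ecols g v.
  by rewrite mem_avoid mem_iota => /andP[].
have R7 v c : c \in R v -> c != 7 by move=> /RP[+ _]; case: eqP => // ->.
have [v|v|a0 [a0R a0_adj]] := @greedy_values G (same_side A) R (fun _ c => c) mateS mateI R_uniq.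
- by [].
- by apply: leq_ltn_trans (cardA v) _; apply: ltnW; apply: R_size.
(* Of two neighbors in A, the first one has vertex color 7, the other one has
   pendant color 7. *)
pose top v := [forall w, same_side A v w ==> (enum_rank v < enum_rank w)].
have topP u v : same_side A u v -> top u = ~~ top v.
  move=> uv; have uv' : u != v by apply: contraTneq uv => ->; rewrite mateI.
  have top1 x y : same_side A x y -> top x = (enum_rank x < enum_rank y).
    move=> xy; apply/forallP/idP => [/(_ y)|xy' w]; first by rewrite xy.
    by apply/implyP=> xw; rewrite (A1 _ _ _ xw xy).
  rewrite (top1 _ _ uv) (top1 v u) 1?mateS // -leqNgt [RHS]leq_eqVlt.
  by rewrite orb_idl // => /eqP/ord_inj/enum_rank_inj uv2; rewrite uv2 eqxx in uv'.
(* The vertices of A that need another vertex color than 7 are colored after B: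
   they have at most two neighbors in B. *)
pose cross v := [seq a0 w | w <- nbrs v & w \notin A].
pose a v := if v \notin A then a0 v else
  if top v then 7 else head 0 (avoid (R v) (cross v)).
have head_mem (l : seq nat) : 0 < size l -> head 0 l \in l.
  by case: l => //= c l _; rewrite inE eqxx.
have aNtop v : v \in A -> ~~ top v -> a v \in avoid (R v) (cross v).
  move=> vA v_top; rewrite /a vA (negPf v_top) /=; apply: head_mem.
  apply: leq_trans (size_avoid _ (R_uniq v)); rewrite subn_gt0.
  apply: leq_trans (R_size v).
  have [w vw] : exists w, same_side A v w.
    move: v_top; rewrite negb_forall => /existsP[w]; rewrite negb_imply.
    by case/andP; exists w.
  have /andP[avw /eqP vwA] := vw.
  rewrite size_map -[size _]/(size [seq w <- nbrs v | w \notin A]) size_filter.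
  have := count_predC (mem A) (nbrs v); rewrite size_nbrs.
  suff : 0 < count (mem A) (nbrs v).
    by have := deg3 v; rewrite -[X in _ -> _ -> X < _]/(count (predC (mem A)) (nbrs v)); lia.
  by rewrite -has_count; apply/hasP; exists w; rewrite ?mem_nbrs //= -vwA.
have a_range v : 0 < a v <= 7 /\ a v \notin ecols g v.
  have R_ok c : c \in R v -> 0 < c <= 7 /\ c \notin ecols g v.
    by move=> /RP[/andP[-> /ltnW->]].
  case: (boolP (v \in A)) => vA; last by rewrite /a vA; apply: R_ok.
  case: (boolP (top v)) => [vt|/(aNtop _ vA)]; last first.
    by rewrite mem_avoid => /andP[_ /R_ok].
  rewrite /a vA vt; split=> //; apply/mapP => -[w].
  by rewrite mem_nbrs => /gP + E; rewrite -E ltnn andbF.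
have a_cross u v : u \in A -> v \notin A -> adj u v -> a u != a v.
  move=> uA vA uv; rewrite [a v]/a vA.
  case: (boolP (top u)) => ut; first by rewrite /a uA ut eq_sym; apply: R7 (a0R v).
  have := aNtop u uA ut; rewrite mem_avoid => /andP[+ _]; apply: contraNneq => ->.
  by apply/mapP; exists v; rewrite // mem_filter vA mem_nbrs.
have a_top u v : same_side A u v -> u \in A -> top u -> a u != a v.
  move=> uv uA ut; have /andP[_ /eqP uvA] := uv; have := ut; rewrite (topP _ _ uv) => vt.
  have := aNtop v; rewrite -uvA uA vt => /(_ isT isT).
  by rewrite mem_avoid => /andP[_ /R7]; rewrite /a uA ut eq_sym.
have aG : proper_pair 7 a g.
  split=> // [v|u v /gP/andP[->]/ltnW->|u v uv|u v uv] //.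
  - by case: (a_range v).
  - case: (boolP (u \in A)) => uA; case: (boolP (v \in A)) => vA.
    + have uv' : same_side A u v by rewrite /same_side uv uA vA.
      case: (boolP (top u)) => ut; first exact: a_top.
      by rewrite eq_sym a_top 1?mateS //; move: ut; rewrite (topP _ _ uv') negbK.
    + exact: a_cross.
    + by rewrite eq_sym a_cross // adj_sym.
    + by rewrite /a uA vA a0_adj // /same_side uv (negPf uA) (negPf vA).
  - by have [_] := a_range u; apply: contraNneq => <-; apply: mem_ecols.
pose vp := vertex_product a g; have vp_gt0 v : 0 < vp v := vertex_product_gt0 v aG.
have Ra_size v : 1 < size (avoid (R v) [:: a v]).
  by apply: leq_trans (size_avoid _ (R_uniq v)); have := R_size v; rewrite /=; lia.
have [|v c c' _ _|v|s0 [s0R s0_adj]] := @greedy_values G (same_side A)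
  (fun v => avoid (R v) [:: a v]) (fun v c => vp v * c) mateS mateI.
- by move=> v; rewrite avoid_uniq.
- by move=> /eqP; rewrite eqn_pmul2l // => /eqP.
- by apply: leq_ltn_trans (cardA v) (Ra_size v).
(* The pendant color that would give v the product of its neighbor in A, whose
   pendant color is 7. *)
pose mate_value v := [seq vp w * 7 %/ vp v | w <- enum [set w | same_side A v w]].
pose s v := if v \notin A then s0 v else
  if top v then head 0 (avoid (R v) (mate_value v)) else 7.
have s_top v : v \in A -> top v -> s v \in avoid (R v) (mate_value v).
  move=> vA vt; rewrite /s vA vt /=; apply: head_mem.
  apply: leq_trans (size_avoid _ (R_uniq v)); rewrite size_map -cardE subn_gt0.
  by apply: leq_ltn_trans (cardA v) _; apply: ltnW; apply: R_size.
have s_range v : [/\ 0 < s v <= 7, s v != a v & s v \notin ecols g v].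
  case: (boolP (v \in A)) => vA; last first.
    rewrite /s vA /=; have := s0R v; rewrite mem_avoid inE => /andP[-> /RP[+ ->]].
    by case/andP=> -> /ltnW->.
  case: (boolP (top v)) => vt.
    have := s_top v vA vt; rewrite mem_avoid => /andP[_ sR].
    have [/andP[s_gt0 s7] sg] := RP _ _ sR.
    have av7 : a v = 7 by rewrite /a vA vt.
    by rewrite av7 s_gt0 sg ltnW // (R7 _ _ sR).
  rewrite /s vA (negPf vt) /=; split=> //.
    by have := aNtop v vA vt; rewrite mem_avoid eq_sym => /andP[_ /R7].
  by apply/mapP => -[w]; rewrite mem_nbrs => /gP + E; rewrite -E ltnn andbF.
have prod7 v : (7 %| vp v * s v) = (v \in A).
  case: (boolP (v \in A)) => vA.
    rewrite Euclid_dvdM // /vp /vertex_product Euclid_dvdM //.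
    case: (boolP (top v)) => vt; first by rewrite {1}/a vA vt.
    by rewrite /s vA (negPf vt) orbT.
  apply/negbTE; have lt7 c : 0 < c < 7 -> ~~ (7 %| c).
    by case/andP=> c_gt0 c7; apply: ndvd_small; [lia|move: c7; case: eqP => // ->].
  rewrite Euclid_dvdM // negb_or /vp vertex_product_ndvd //=.
  - have := s0R v; rewrite /s vA mem_avoid => /andP[_ /RP[+ _]]; exact: lt7.
  - by rewrite /a vA; have [+ _] := RP _ _ (a0R v); apply: lt7.
  - by move=> w /gP; apply: lt7.
have dist_top u v : same_side A u v -> u \in A -> top u -> vp u * s u != vp v * s v.
  move=> uv uA ut; have /andP[_ /eqP uvA] := uv; have vA : v \in A by rewrite -uvA.
  have vt : ~~ top v by rewrite -(topP _ _ uv).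
  rewrite [s v]/s vA (negPf vt) /=.
  have := s_top u uA ut; rewrite mem_avoid => /andP[+ _]; apply: contraNneq => E.
  by apply/mapP; exists v; rewrite ?mem_enum ?inE // -E mulKn.
exists a, g, s; split=> // [v c|v|u v uv|u v uv].
- by rewrite inE => /eqP->; case: (s_range v).
- by rewrite inE eq_sym; case: (s_range v).
- by rewrite inE; have [_ _] := s_range u; apply: contraNneq => <-; apply: mem_ecols.
rewrite !core_product1 -/vp.
case: (boolP (same_side A u v)) => [uv'|]; last first.
  by rewrite /same_side uv /= -!prod7; apply: contraNneq => ->.
have /andP[_ /eqP uvA] := uv'.
case: (boolP (u \in A)) => uA; last by rewrite /s -uvA uA /= s0_adj.
case: (boolP (top u)) => ut; first exact: dist_top.
rewrite eq_sym dist_top 1?mateS // -?uvA //.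
by move: ut; rewrite (topP _ _ uv') negbK.
Qed.

End CoreCut.

(** * Assembling a coloring of the corona product *)

Section Copy.
Variable H : graph.

(** Coloring of one copy of [H]: the vertex it is joined to has color [a] and product
    [P], and the edge from that vertex to [u] has color [p u]. *)
Record copy_coloring k a (p : H -> nat) P (x : H -> nat) (e : H -> H -> nat) :
    Prop := CopyColoring {
  copy_pair : proper_pair k x e;
  copy_center : forall u, x u != a;
  copy_pend : forall u, x u != p u;
  copy_epend : forall u t, adj u t -> e u t != p u;
  copy_dist : forall u t, adj u t ->
    p u * vertex_product x e u != p t * vertex_product x e t;
  copy_far : forall u, p u * vertex_product x e u != P }.

Definition copy_colorable k a p P := exists x e, copy_coloring k a p P x e.

(** The pendant colors are handed out to the vertices of a copy in the order of
    their enumeration. *)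
Definition pendant (S : seq nat) (u : H) := nth 0 S (enum_rank u).

Section Pendant.
Variable S : seq nat.
Hypothesis S_size : size S = #|H|.

Lemma pendant_mem u : pendant S u \in S.
Proof. by rewrite mem_nth // S_size ltn_ord. Qed.

Lemma pendant_inj : uniq S -> injective (pendant S).
Proof.
move=> S_uniq u t /eqP; rewrite nth_uniq ?S_size ?ltn_ord //.
by move=> /eqP/ord_inj/enum_rank_inj.
Qed.

Lemma prod_pendant : \prod_u pendant S u = \prod_(c <- S) c.
Proof.
rewrite (big_nth 0) big_mkord S_size (reindex (@enum_rank H)) //.
by exists (@enum_val _ H) => u _; rewrite ?enum_rankK ?enum_valK.
Qed.

End Pendant.
End Copy.

(** Once the core is colored, the copies no longer interact. *)
Lemma corona_colorable (G H : graph) k (a : G -> nat) g S :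
  core_coloring k a g S -> (forall v, size (S v) = #|H|) ->
  (forall v, @copy_colorable H k (a v) (pendant (S v)) (core_product a g S v)) ->
  npd_total_colorable (corona G H) k.
Proof.
move=> core S_size /fin_all_exists[xH] /fin_all_exists[eH copy].
pose p v := @pendant H (S v).
pose x (y : corona G H) := match y with inl v => a v | inr (v, u) => xH v u end.
pose e (y z : corona G H) := match y, z with
  | inl v, inl w => g v w
  | inl _, inr (v, u) => p v u
  | inr (v, u), inl _ => p v u
  | inr (v, u), inr (w, t) => if v == w then eH v u t else 0
  end.
have [[a_range g_range g_sym a_adj a_g g_adj] S_uniq S_range S_a S_g dist] := core.
have pS v u : p v u \in S v by apply: pendant_mem.
have p_inj v : injective (p v) by apply: pendant_inj.
have prod_center v : vertex_product x e (inl v : corona G H) = core_product a g S v.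
  rewrite /vertex_product big_sumType /= /core_product /vertex_product mulnA.
  congr (_ * _); rewrite -(prod_pendant (S_size v)).
  rewrite (reindex_onto (pair v) snd) /=; last by move=> [w u] /eqP->.
  by apply: eq_bigl => u; rewrite !eqxx.
have prod_copy v u : vertex_product x e (inr (v, u) : corona G H) =
    p v u * vertex_product (xH v) (eH v) u.
  rewrite /vertex_product big_sumType /= mulnCA; congr (_ * _).
    by rewrite (big_pred1 v) => [|w] //; rewrite eq_sym.
  congr (_ * _); rewrite (reindex_onto (pair v) snd) /=; last first.
    by move=> [w t] /andP[/eqP->].
  by apply: eq_big => t; rewrite !eqxx ?andbT.
apply: (@npd_colorable_of_fun (corona G H) k x e).
  split.
  - case=> [v|[v u]] //=; exact: vcol_range (copy_pair (copy v)) u.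
  - case=> [v|[v u]] [w|[w t]] //=.
    + exact: g_range.
    + by move=> _; apply: S_range (pS w t).
    + by move=> _; apply: S_range (pS v u).
    + by case/andP=> /eqP-> ut; rewrite eqxx; apply: ecol_range (copy_pair (copy w)) _ _ ut.
  - case=> [v|[v u]] [w|[w t]] //=; rewrite eq_sym; case: eqP => // ->.
    exact: ecol_sym (copy_pair (copy _)) _ _.
  - case=> [v|[v u]] [w|[w t]] //=.
    + exact: a_adj.
    + by move=> /eqP->; rewrite eq_sym (copy_center (copy w)).
    + by move=> /eqP->; rewrite (copy_center (copy w)).
    + by case/andP=> /eqP-> ut; apply: vcol_adj (copy_pair (copy w)) _ _ ut.
  - case=> [v|[v u]] [w|[w t]] //=.
    + exact: a_g.
    + by move=> /eqP->; apply: contraNneq (S_a w) => <-.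
    + by move=> _; rewrite eq_sym (copy_pend (copy v)).
    + by case/andP=> /eqP-> ut; rewrite eqxx; apply: vcol_ecol (copy_pair (copy w)) _ _ ut.
  - case=> [v|[v u]] [w|[w t]] [w'|[w' t']] //=.
    + exact: g_adj.
    + by move=> vw /eqP<- _; apply: contraNneq (S_g _ _ vw) => ->.
    + by move=> /eqP<- vw _; apply: contraNneq (S_g _ _ vw) => <-.
    + move=> /eqP<- /eqP<-; apply: contra => /eqP/p_inj->; exact: eqxx.
    + by move=> /eqP<- /eqP<-; rewrite eqxx.
    + move=> _ /andP[/eqP<- ut] _; rewrite eqxx eq_sym.
      exact: copy_epend (copy v) _ _ ut.
    + move=> /andP[/eqP<- ut] _ _; rewrite eqxx.
      exact: copy_epend (copy v) _ _ ut.
    + move=> /andP[/eqP<- ut] /andP[/eqP<- ut'] tt'; rewrite eqxx.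
      apply: (ecol_adj (copy_pair (copy v)) ut ut').
      by apply: contra tt' => /eqP->.
case=> [v|[v u]] [w|[w t]] /=; rewrite ?prod_center ?prod_copy.
- exact: dist.
- by move=> /eqP->; rewrite eq_sym (copy_far (copy w)).
- by move=> /eqP->; rewrite (copy_far (copy w)).
- by case/andP=> /eqP-> ut; apply: copy_dist (copy w) _ _ ut.
Qed.

(** * Coloring the copies *)

Section CopyTheory.
Variable H : graph.
Implicit Types (u v w t : H).

Definition uncolored_product (p : H -> nat) (e : H -> H -> nat) u :=
  p u * \prod_(t | adj u t) e u t.

Lemma copy_productE p x e u :
  p u * vertex_product x e u = x u * uncolored_product p e u.
Proof. by rewrite mulnCA. Qed.

(** A vertex avoids [a], [p u], the one color that would give the product [P], and
    the colors of its at most [h] edges; each neighbor excludes two more colors. *)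
Lemma copy_colorable_plain h k a (p : H -> nat) P :
  max_degree H <= h -> 3 * h + 3 < k -> (forall u, 0 < p u) ->
  copy_colorable k a p P.
Proof.
move=> Hh h_k p_gt0; have deg_h u : degree u <= h := leq_trans (degree_max u) Hh.
have [||||e [e_sym eP e_adj]] :=
  @greedy_edges H h 1 (iota 1 k) (fun u => [:: p u]) => //.
- exact: iota_uniq.
- by rewrite size_iota; lia.
have {}eP u t : adj u t -> 0 < e u t <= k /\ e u t != p u.
  by move=> /eP; rewrite mem_avoid inE mem_iota add1n => /andP[].
pose M := uncolored_product p e.
have M_gt0 u : 0 < M u.
  by rewrite muln_gt0 p_gt0 prod_gt0 // => t /eP[/andP[]].
pose avail u := avoid (iota 1 k) [:: a, p u, P %/ M u & ecols e u].
have adj_irr' u : ~~ adj u u by rewrite adj_irr.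
have [||u|x [x_av x_adj]] := @greedy_separated H (@adj H) avail M (@adj_sym H) adj_irr'.
- by move=> u; rewrite avoid_uniq ?iota_uniq.
- by [].
- apply: leq_trans (size_avoid _ (iota_uniq _ _)).
  rewrite /= size_ecols size_iota; have := deg_h u.
  by rewrite -/(degree u); lia.
have xP u : [/\ 0 < x u <= k, x u != a, x u != p u, x u != P %/ M u
               & x u \notin ecols e u].
  have := x_av u; rewrite mem_avoid !inE mem_iota add1n !negb_or.
  by case/andP=> /and4P[-> -> -> ->].
exists x, e; split=> [|u|u|u t /eP[]//|u t ut|u].
- split=> // [u|u t /eP[]//|u t /x_adj[]//|u t ut]; first by case: (xP u).
  by have [_ _ _ _] := xP u; apply: contraNneq => <-; apply: mem_ecols.
- by case: (xP u).
- by case: (xP u).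
- by rewrite (copy_productE p x e u) (copy_productE p x e t); case: (x_adj _ _ ut).
- rewrite (copy_productE p x e u) -/M; have [_ _ _ + _] := xP u.
  by apply: contraNneq => <-; rewrite mulnK.
Qed.

(** The vertices of one side [A] of a largest cut are marked with the prime [q], the
    only color that it divides: edges inside [A] have color [q], and so do the
    vertices of [A] without neighbor in [A]. No vertex or edge on the other side [B]
    has color [q], nor has a pendant edge. Thus products across the cut differ, those
    in [A] differ from [P], and at most one neighbor per vertex remains. *)
Lemma copy_colorable_marked h q k a (p : H -> nat) P :
  subcubic H -> max_degree H <= h -> h + 7 <= k -> 2 * h + 4 <= k ->
  prime q -> q <= k < 2 * q -> (forall u, 0 < p u <= k) -> a != q ->
  (forall u, p u != q) -> ~~ (q %| P) -> copy_colorable k a p P.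
Proof.
move=> H3 Hh hk hk2 q_pr /andP[q_k k_q] p_range aq pq qP.
have deg_h u : degree u <= h := leq_trans (degree_max u) Hh.
have [A A1] := subcubic_cut H3; have cardA v := card_same_side v A1.
have mateS := same_side_sym A; have mateI := @same_side_irr _ A.
pose pal := rem q (iota 1 k).
have pal_uniq : uniq pal by rewrite rem_uniq ?iota_uniq.
have mem_pal c : (c \in pal) = (c != q) && (0 < c <= k).
  by rewrite mem_rem_uniq ?iota_uniq // inE /= mem_iota add1n.
have pal_size : size pal = k.-1.
  by rewrite size_rem ?size_iota ?mem_iota ?add1n //= ltnS q_k prime_gt0.
have ndvd c : c != q -> 0 < c <= k -> ~~ (q %| c).
  by move=> cq /andP[c_gt0 c_k]; apply: ndvd_small; rewrite // c_gt0 (leq_ltn_trans c_k).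
have [||||e0 [e0_sym e0P e0_adj]] :=
  @greedy_edges H h 1 pal (fun u => [:: p u]) => //.
  by rewrite pal_size; lia.
have {}e0P u t : adj u t -> [/\ 0 < e0 u t <= k, e0 u t != q & e0 u t != p u].
  by move=> /e0P; rewrite mem_avoid inE mem_pal => /and3P[].
pose e u t := if (u \in A) && (t \in A) then q else e0 u t.
have e_sym u t : e u t = e t u by rewrite /e andbC e0_sym.
have eP u t : adj u t -> 0 < e u t <= k /\ e u t != p u.
  by move=> /e0P[? _ ?]; rewrite /e; case: ifP => // _; rewrite prime_gt0 // eq_sym.
have e_adj u t w : adj u t -> adj u w -> t != w -> e u t != e u w.
  move=> ut uw tw; rewrite /e; case: (boolP (u \in A)) => uA /=; last exact: e0_adj.
  have [_ t_q _] := e0P _ _ ut; have [_ w_q _] := e0P _ _ uw.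
  case: (boolP (t \in A)) => tA; case: (boolP (w \in A)) => wA //.
  - by case/eqP: tw; apply: (A1 u); rewrite /same_side ?ut ?uw uA ?tA ?wA.
  - by rewrite eq_sym.
  - exact: e0_adj.
pose M := uncolored_product p e.
have M_gt0 u : 0 < M u.
  rewrite muln_gt0 prod_gt0 => [|t /eP[/andP[]]//].
  by case/andP: (p_range u) => ->.
pose availB u := avoid pal [:: a, p u, P %/ M u & ecols e u].
have [||u|xB [xB_av xB_adj]] := @greedy_separated H (same_side A) availB M mateS mateI.
- by move=> u; rewrite avoid_uniq.
- by [].
- apply: leq_trans (size_avoid _ pal_uniq).
  by rewrite /= size_ecols pal_size; have := deg_h u; have := cardA u; lia.
have xBP u : [/\ 0 < xB u <= k, xB u != q, xB u != a, xB u != p u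
               & xB u != P %/ M u /\ xB u \notin ecols e u].
  have := xB_av u; rewrite mem_avoid !inE mem_pal !negb_or.
  by case/andP=> /and4P[-> -> -> ->] /andP[-> ->].
(* The vertices of A that have a neighbor in A are colored after B; q is one of
   their edge colors, which saves one color in the count. *)
pose paired u := [exists t, same_side A u t].
pose cross u := [seq xB t | t <- nbrs u & t \notin A].
pose availA u := if (u \in A) && paired u
  then avoid (iota 1 k) ([:: a, p u & ecols e u] ++ cross u) else iota 1 k.
have [||u|xA [xA_av xA_adj]] := @greedy_separated H (same_side A) availA M mateS mateI.
- by move=> u; rewrite /availA; case: ifP; rewrite ?avoid_uniq ?iota_uniq.
- by [].
- rewrite /availA; case: ifP => [/andP[uA /existsP[t ut]]|_]; last first.
    by rewrite size_iota; have := cardA u; lia.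
  apply: leq_trans (size_avoid _ (iota_uniq _ _)).
  rewrite size_cat /= size_ecols size_iota size_map size_filter.
  have cross_h : count (predC (mem A)) (nbrs u) < h.
    have /andP[aut /eqP utA] := ut; have := count_predC (mem A) (nbrs u).
    rewrite size_nbrs; suff : 0 < count (mem A) (nbrs u) by have := deg_h u; lia.
    by rewrite -has_count; apply/hasP; exists t; rewrite ?mem_nbrs //= -utA.
  have := deg_h u; have := cardA u.
  by rewrite -[count _ (nbrs u)]/(count (predC (mem A)) (nbrs u)); lia.
have xAP u : u \in A -> paired u -> [/\ 0 < xA u <= k, xA u != a, xA u != p u,
               xA u \notin ecols e u & xA u \notin cross u].
  move=> uA u2; have := xA_av u.
  rewrite /availA uA u2 mem_avoid mem_cat !inE mem_iota add1n !negb_or.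
  by case/andP=> /andP[/and3P[-> -> ->] ->].
pose x u := if u \notin A then xB u else if paired u then xA u else q.
have x_range u : [/\ 0 < x u <= k, x u != a & x u != p u].
  rewrite /x; case: (boolP (u \in A)) => uA; last by case: (xBP u).
  case: (boolP (paired u)) => u2; first by case: (xAP u uA u2).
  by rewrite /= prime_gt0 // eq_sym aq eq_sym pq.
have x_e u : x u \notin ecols e u.
  rewrite /x; case: (boolP (u \in A)) => uA; last by case: (xBP u) => _ _ _ _ [].
  case: (boolP (paired u)) => u2; first by case: (xAP u uA u2).
  apply/mapP => -[t]; rewrite mem_nbrs /e uA /= => ut.
  case: (boolP (t \in A)) => tA; last first.
    by have [_ + _] := e0P _ _ ut => + qE; rewrite -qE eqxx.
  by case/negP: u2; apply/existsP; exists t; rewrite /same_side ut uA tA.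
have x_cross u t : adj u t -> u \in A -> t \notin A -> x u != x t.
  move=> ut uA tA; rewrite [x t]/x tA /x uA /=.
  case: (boolP (paired u)) => u2; last by have [_ + _ _ _] := xBP t; rewrite eq_sym.
  have [_ _ _ _] := xAP u uA u2; apply: contraNneq => ->.
  by apply/mapP; exists t; rewrite // mem_filter tA mem_nbrs.
have x_mate u t : same_side A u t -> x u != x t /\ x u * M u != x t * M t.
  move=> ut; have /andP[_ /eqP utA] := ut; rewrite /x -utA.
  case: (boolP (u \in A)) => uA /=; last exact: xB_adj.
  have -> : paired u by apply/existsP; exists t.
  by have -> : paired t; [apply/existsP; exists u; rewrite mateS|apply: xA_adj].
have dvd_q u : (q %| x u * M u) = (u \in A).
  rewrite Euclid_dvdM //; case: (boolP (u \in A)) => uA.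
    case: (boolP (paired u)) => u2; last by rewrite /x uA (negPf u2) dvdnn.
    have /existsP[t /andP[ut /eqP utA]] := u2; apply/orP; right.
    rewrite /M /uncolored_product (bigD1 t) //= /e -utA uA /=.
    by rewrite mulnCA dvdn_mulr.
  apply/negbTE; rewrite negb_or /x uA /= Euclid_dvdM // negb_or.
  have [xr xq _ _ _] := xBP u; rewrite (ndvd (xB u)) // (ndvd (p u)) //= ndvd_prod // => t ut.
  by rewrite /e (negPf uA) /=; case: (e0P _ _ ut) => ? ? _; apply: ndvd.
exists x, e; split=> [|u|u|u t /eP[]//|u t ut|u].
- split=> // [u|u t /eP[]//|u t ut|u t ut]; first by case: (x_range u).
  + case: (boolP (same_side A u t)) => [/x_mate[]//|]; rewrite /same_side ut /=.
    case: (boolP (u \in A)) => uA; case: (boolP (t \in A)) => tA // _.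
      exact: x_cross.
    by rewrite eq_sym x_cross // adj_sym.
  + by apply: contraNneq (x_e u) => <-; apply: mem_ecols.
- by case: (x_range u).
- by case: (x_range u).
- rewrite (copy_productE p x e u) (copy_productE p x e t) -/M.
  case: (boolP (same_side A u t)) => [/x_mate[]//|].
  by rewrite /same_side ut /= -!dvd_q; apply: contraNneq => ->.
- rewrite (copy_productE p x e u) -/M; case: (boolP (u \in A)) => uA.
    by apply: contraNneq qP => <-; rewrite dvd_q.
  rewrite /x uA /=; have [_ _ _ _ [+ _]] := xBP u.
  by apply: contraNneq => <-; rewrite mulnK.
Qed.

End CopyTheory.

(** * Small copies by computation *)

(** Products are compared in binary, to make the computation fast. *)
Definition prodN (s : seq nat) : N := foldr (fun c m => N.mul (N.of_nat c) m) 1%num s.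

Lemma prodNE s : prodN s = N.of_nat (\prod_(c <- s) c).
Proof.
elim: s => [|c s IHs] /=; first by rewrite big_nil.
by rewrite big_cons IHs -Nat2N.inj_mul.
Qed.

(** The products of [b] with the subsets of [Y]: the possible products at a vertex
    of the core whose edges have colors in [Y]. *)
Fixpoint subproducts (Y : seq nat) (b : N) : seq N :=
  if Y is y :: Y' then subproducts Y' b ++ subproducts Y' (N.mul (N.of_nat y) b)
  else [:: b].

Lemma mem_subproducts (g : pred nat) Y b :
  N.of_nat (\prod_(y <- Y | g y) y * b) \in subproducts Y (N.of_nat b).
Proof.
elim: Y b => [|y Y IHY] b /=; first by rewrite big_nil mul1n inE.
rewrite mem_cat big_cons; case: (g y); last by rewrite IHY.
rewrite -Nat2N.inj_mul; apply/orP; right.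
by rewrite -mulnA mulnCA; apply: IHY.
Qed.

(** A graph on the vertices 0, ..., [n - 1] with colored edges is a list of pairs of
    an edge [(i, j)], [i < j], and a color; a vertex coloring is a list of length
    [n]. *)
Section FirstFit.
Variables (k n a : nat) (S : seq nat) (Ps : seq N).

Implicit Types (w : nat * nat) (z : nat * nat * nat) (i j : nat).

Definition touch i w := (w.1 == i) || (w.2 == i).

Definition colors_at (ces : seq (nat * nat * nat)) i :=
  [seq z.2 | z <- ces & touch i z.1].

Definition local_product ces (xs : seq nat) i :=
  prodN [:: nth 0 xs i, nth 0 S i & colors_at ces i].

(** The colorings found by the first-fit procedures below are tested here, so these
    procedures need no correctness proof. *)
Definition valid ces xs : bool :=
  let Qs := [seq local_product ces xs i | i <- iota 0 n] in
  [&& all (fun z => 0 < z.2 <= k) ces,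
      all (fun i => [&& 0 < nth 0 xs i <= k, nth 0 xs i != a
                      & uniq [:: nth 0 xs i, nth 0 S i & colors_at ces i]]) (iota 0 n),
      all (fun Q => Q \notin Ps) Qs
    & all (fun z => (nth 0 xs z.1.1 != nth 0 xs z.1.2) &&
                    (nth 0%num Qs z.1.1 != nth 0%num Qs z.1.2)) ces].

Fixpoint first_fit (ok : pred nat) (cs : seq nat) : nat :=
  if cs is c :: cs' then if ok c then c else first_fit ok cs' else 0.

Definition edge_fit ces w :=
  let forb := [:: nth 0 S w.1, nth 0 S w.2
                & colors_at ces w.1 ++ colors_at ces w.2] in
  first_fit (fun c => c \notin forb) (iota 1 k).

Fixpoint vertex_fit ces m (xPs : seq (nat * N)) : seq (nat * N) :=
  if m is m'.+1 then
    let i := size xPs in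
    let forb := nth 0 S i :: colors_at ces i in
    let M := prodN forb in
    let prev := [seq nth (0, 0%num) xPs z.1.1 | z <- ces & z.1.2 == i] in
    let ok c := if c \in a :: forb then false else
      let P := N.mul (N.of_nat c) M in
      if P \in Ps then false else all (fun q => (q.1 != c) && (q.2 != P)) prev in
    let c := first_fit ok (iota 1 k) in
    vertex_fit ces m' (rcons xPs (c, N.mul (N.of_nat c) M))
  else xPs.

Definition leaf ces := valid ces (unzip1 (vertex_fit ces n [::])).

(** Runs over all graphs of maximum degree at most three with edges in [ws] and those
    of [ces]. A graph inherits the edge coloring of its initial part, so that edges
    are colored along the way. Under call-by-value evaluation a boolean operator
    would also explore the branches that the nested conditionals skip. *)
Fixpoint explore (ws : seq (nat * nat)) ces : bool :=
  if ws is w :: ws' then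
    if explore ws' ces then
      if 2 < size (colors_at ces w.1) then true else
      if 2 < size (colors_at ces w.2) then true else
      explore ws' ((w, edge_fit ces w) :: ces)
    else false
  else leaf ces.

Definition pairs := [seq w <- [seq (i, j) | i <- iota 0 n, j <- iota 0 n] | w.1 < w.2].

Definition copy_check := explore pairs [::].

End FirstFit.

(** The palettes for vertices, edges and the first pendant edge of a core of maximum
    degree [d]. They are chosen among 1, ..., [d + 4] so that first-fit succeeds on
    all copies. *)
Definition core_vertex_colors d :=
  nth [::] [:: [:: 2]; [:: 1; 2]; [:: 4; 5; 6]] d.
Definition core_edge_colors d :=
  nth [::] [:: [:: 3]; [:: 3]; [:: 1; 2; 3]] d.
Definition core_pendant_colors d :=
  nth [::] [:: [:: 1]; [:: 3; 4; 5]; [:: 1; 2; 3; 4; 5; 6]] d.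

Definition small_check d n :=
  all (fun a => all (fun s =>
      (a == s) || let S := s :: iota (d + 5) n.-1 in
        copy_check (n + d + 3) n a S
          (subproducts (core_edge_colors d) (prodN (a :: S))))
    (core_pendant_colors d)) (core_vertex_colors d).

Lemma size_colors_at ces i : size (colors_at ces i) = count (touch i) (unzip1 ces).
Proof. by rewrite size_map size_filter count_map. Qed.

(** Each choice of edges among [ws], given by [sel], is a branch of the exploration as
    long as no degree exceeds three. *)
Lemma explore_sound k n a S Ps ws ces (sel : pred (nat * nat)) :
  explore k n a S Ps ws ces ->
  (forall i, count (touch i) (unzip1 ces) + count (touch i) (filter sel ws) <= 3) ->
  exists ces', unzip1 ces' = catrev (filter sel ws) (unzip1 ces) /\
    leaf k n a S Ps ces'.
Proof.
elim: ws ces => [|w ws IHws] ces /=; first by exists ces.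
case: ifP => // skip; rewrite !size_colors_at => take deg.
case: (boolP (sel w)) deg => selw deg; last exact: IHws.
case: ifP take => [w1|_].
  by have := deg w.1; rewrite /= {2}/touch eqxx; lia.
case: ifP => [w2 _|_ /IHws take].
  by have := deg w.2; rewrite /= {2}/touch eqxx orbT; lia.
by apply: take => i; apply: leq_trans (deg i); rewrite /=; lia.
Qed.

Lemma uniq_map_neq (T1 T2 : eqType) (f : T1 -> T2) s x y : uniq [seq f z | z <- s] ->
  x \in s -> y \in s -> x != y -> f x != f y.
Proof.
elim: s => //= z s IHs /andP[zs us]; rewrite !inE.
have fs y1 : y1 \in s -> f y1 != f z by move=> y1s; apply: contraNneq zs => <-; apply: map_f.
case/predU1P=> [->|xs] /predU1P[->|ys] //; first by rewrite eqxx.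
- by rewrite (eq_sym (f z)) fs.
- by rewrite fs.
- exact: IHs.
Qed.

Section Check.
Variables (H : graph) (k a : nat) (S : seq nat) (Ps : seq N).
Hypothesis H3 : subcubic H.
Implicit Types (u t : H) (w : nat * nat).

Let n := #|H|.
Let r u : nat := enum_rank u.

(** The edge of the enumerated graph that comes from two vertices. *)
Definition link u t := if r u < r t then (r u, r t) else (r t, r u).

Definition selected w := [exists u, exists t, adj u t && (w == (r u, r t))].

Let E := [seq w <- pairs n | selected w].

Lemma rank_inj : injective r.
Proof. by move=> u t /ord_inj/enum_rank_inj. Qed.

Lemma link_sym u t : link u t = link t u.
Proof. by rewrite /link; case: ltngtP => // ->. Qed.

Lemma link_sum u t : (link u t).1 + (link u t).2 = r u + r t.
Proof. by rewrite /link; case: ifP => _ //=; apply: addnC. Qed.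

Lemma link_inj u : injective (link u).
Proof.
move=> t t' E2; have := link_sum u t; rewrite E2 link_sum => /eqP.
by rewrite eqn_add2l => /eqP/rank_inj.
Qed.

Lemma touch_link u t : touch (r u) (link u t).
Proof. by rewrite /touch /link; case: ifP; rewrite /= eqxx ?orbT. Qed.

Lemma selected_uniq : uniq E.
Proof.
by rewrite !filter_uniq // allpairs_uniq ?iota_uniq // => -[i j] [i' j'] _ _ /= [-> ->].
Qed.

Lemma mem_link u t : adj u t -> link u t \in E.
Proof.
have rn v : r v < n by apply: ltn_ord.
move=> ut; rewrite !mem_filter; apply/and3P; split.
- apply/existsP; rewrite /link; case: ifP => _.
    by exists u; apply/existsP; exists t; rewrite ut eqxx.
  by exists t; apply/existsP; exists u; rewrite adj_sym ut eqxx.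
- rewrite /link; case: (ltngtP (r u) (r t)) => // /rank_inj E1.
  by rewrite E1 adj_irr in ut.
- by apply/allpairsP; exists (link u t); rewrite !mem_iota /= /link; case: ifP; rewrite !rn.
Qed.

Lemma selectedP w : w \in E -> exists u t, [/\ adj u t, w = (r u, r t) & w = link u t].
Proof.
rewrite !mem_filter => /and3P[/existsP[u /existsP[t /andP[ut /eqP->]]] /= rut _].
by exists u, t; rewrite /link rut.
Qed.

Lemma star_perm u :
  perm_eq [seq w <- E | touch (r u) w] [seq link u t | t <- nbrs u].
Proof.
apply: uniq_perm; first exact/filter_uniq/selected_uniq.
  by rewrite (map_inj_uniq (@link_inj u)) nbrs_uniq.
move=> w; rewrite mem_filter; apply/andP/mapP => [[]|[t]].
  move=> + /selectedP[u' [t [u't wE lk]]]; rewrite {2}lk wE /touch /=.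
  case/orP=> /eqP/rank_inj<-; first by exists t; rewrite ?mem_nbrs.
  by exists u'; rewrite 1?link_sym ?mem_nbrs 1?adj_sym.
by rewrite mem_nbrs => /mem_link ? ->; rewrite touch_link.
Qed.

Lemma explore_degree i : count (touch i) E <= 3.
Proof.
have [[u ->]|no_u] : (exists u, i = r u) \/ (forall u, i != r u).
- case: (ltnP i n) => i_n; last first.
    by right=> u; apply: contraTneq i_n => ->; rewrite -ltnNge; apply: ltn_ord.
  by left; exists (enum_val (Ordinal i_n)); rewrite /r enum_valK.
- rewrite -size_filter (perm_size (star_perm u)) size_map size_nbrs.
  exact: leq_trans (degree_max u) H3.
rewrite (@eq_in_count _ _ pred0) ?count_pred0 // => w /selectedP[u [t [_ -> _]]].
by rewrite /touch /= !(eq_sym _ i) (negPf (no_u u)) (negPf (no_u t)).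
Qed.

(** The graph [H], numbered by the enumeration of its vertices, is one of those that
    the computation explores. *)
Lemma copy_colorable_check P :
  copy_check k n a S Ps -> N.of_nat P \in Ps -> copy_colorable k a (@pendant H S) P.
Proof.
move=> check PPs; have [ces [cesE]] := @explore_sound _ _ _ _ _ _ _ selected check explore_degree.
rewrite /leaf.
move: (unzip1 (vertex_fit _ _ _ _ _ _ _)) => xs.
case/and4P=> /allP ces_range /allP xs_ok /allP Qs_ok /allP dist.
have {}cesE : unzip1 ces = rev E by rewrite cesE catrevE cats0.
pose color w := nth 0 (unzip2 ces) (index w (unzip1 ces)).
have ces_uniq : uniq (unzip1 ces) by rewrite cesE rev_uniq selected_uniq.
have colorE z : z \in ces -> color z.1 = z.2.
  move=> zc; rewrite /color; have zi : index z ces < size ces by rewrite index_mem.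
  have -> : index z.1 (unzip1 ces) = index z ces.
    rewrite -{1}(nth_index z zc) -(nth_map z z.1 fst) //.
    by rewrite index_uniq ?size_map.
  by rewrite (nth_map z) // nth_index.
have mem_ces w : w \in E -> exists2 z, z \in ces & z.1 = w.
  by rewrite -mem_rev -cesE => /mapP[z zc ->]; exists z.
pose x u := nth 0 xs (r u); pose e u t := color (link u t).
have cols u : perm_eq (colors_at ces (r u)) (ecols e u).
  rewrite /ecols (map_comp color (link u)).
  have -> : colors_at ces (r u) = [seq color w | w <- unzip1 ces & touch (r u) w].
    rewrite filter_map -map_comp; apply/eq_in_map => z.
    by rewrite mem_filter => /andP[_ /colorE].
  apply: perm_map; apply: perm_trans (star_perm u).
  by rewrite cesE filter_rev perm_rev.
have rn u : r u \in iota 0 n by rewrite mem_iota; apply: ltn_ord.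
have QE u : local_product S ces xs (r u) =
    N.of_nat (@pendant H S u * vertex_product x e u).
  rewrite /local_product prodNE !big_cons (perm_big _ (cols u)) /= big_map.
  by rewrite big_filter big_enum_cond mulnCA.
have Q_nth u : nth 0%num [seq local_product S ces xs i | i <- iota 0 n] (r u) =
    N.of_nat (@pendant H S u * vertex_product x e u).
  have run : r u < n by apply: ltn_ord.
  by rewrite (nth_map 0) ?size_iota // nth_iota // add0n QE.
have xP u : [/\ 0 < x u <= k, x u != a, x u != @pendant H S u,
    x u \notin ecols e u & uniq (@pendant H S u :: ecols e u)].
  have /and3P[-> ->] := xs_ok _ (rn u).
  have /perm_uniq-> : perm_eq [:: nth 0 xs (r u), nth 0 S (r u) & colors_at ces (r u)]
      [:: x u, @pendant H S u & ecols e u] by rewrite !perm_cons cols.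
  by case/andP; rewrite inE negb_or => /andP[-> ->].
have ends u t : adj u t -> [/\ 0 < e u t <= k, x u != x t &
    @pendant H S u * vertex_product x e u != @pendant H S t * vertex_product x e t].
  move=> ut; have [z zc zE] := mem_ces _ (mem_link ut).
  rewrite /e -zE colorE // ces_range //.
  have := dist z zc; rewrite zE /link; case: ifP => _ /=; rewrite !Q_nth => /andP[xut Qut].
    by split=> //; apply: contraNneq Qut => ->.
  by split=> //; [rewrite eq_sym|apply: contraNneq Qut => ->].
exists x, e; split=> [|u|u|u t ut|u t /ends[]//|u].
- split=> [u|u t /ends[]//|u t|u t /ends[]//|u t ut|u t w ut uw tw].
  + by case: (xP u).
  + by rewrite /e link_sym.
  + by have [_ _ _ + _] := xP u; apply: contraNneq => <-; apply: mem_ecols.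
  + have [_ _ _ _ /andP[_ us]] := xP u.
    by apply: (uniq_map_neq us); rewrite ?mem_nbrs.
- by case: (xP u).
- by case: (xP u).
- have [_ _ _ _ /andP[+ _]] := xP u.
  by apply: contraNneq => <-; apply: mem_ecols.
- apply/eqP => QP; have := Qs_ok _ (map_f (local_product S ces xs) (rn u)).
  by rewrite QE QP PPs.
Qed.

End Check.

(** * The theorem *)

Lemma small_check_all :
  all (fun d => all (small_check d) (iota 1 (6 - d))) (iota 0 3).
Proof. by vm_compute. Qed.

Section Main.
Variables G H : graph.
Let n := #|H|.
Implicit Types (a : G -> nat) (g : G -> G -> nat) (S : G -> seq nat).

Lemma max_degree_lt : max_degree H < n.
Proof.
have n_gt0 : 0 < n := vertex_gt0 H.
rewrite -(prednK n_gt0) ltnS; apply/bigmax_leqP => u _.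
rewrite -ltnS prednK // /n -cardsT; apply/proper_card/properP; split.
  exact: subsetT.
by exists u; rewrite inE // adj_irr.
Qed.

Lemma max_degree_corona : n + max_degree G <= max_degree (corona G H).
Proof.
have [v ->] : exists v : G, max_degree G = degree v.
  by have [v] := eq_bigmax (fun v : G => degree v) (vertex_gt0 G); exists v.
apply: leq_trans (degree_max (inl v : corona G H)).
rewrite !degreeE big_sumType /= addnC leq_add2l.
rewrite (reindex_onto (pair v) snd) /=; last by move=> [w u] /eqP->.
rewrite (eq_bigl xpredT) ?sum1_card // => u.
by rewrite !eqxx.
Qed.

Lemma corona_plain h k a g S : core_coloring k a g S ->
  (forall v, size (S v) = n) -> max_degree H <= h -> 3 * h + 3 < k ->
  npd_total_colorable (corona G H) k.
Proof.
move=> core S_size Hh hk; apply: (corona_colorable core) => // v.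
apply: (copy_colorable_plain _ _ Hh hk) => u.
by case/andP: (pend_range core (pendant_mem (S_size v) u)).
Qed.

(** For small orders and small [d] the colors at a vertex of the core are taken from
    fixed lists, so there are finitely many situations for its copy. *)
Lemma corona_checked d : max_degree G <= d -> d <= 2 -> subcubic H ->
  small_check d n -> npd_total_colorable (corona G H) (n + d + 3).
Proof.
move=> Gd d2 H3 check; have n_gt0 : 0 < n := vertex_gt0 H.
have [||||||||a [g [s [core aX gY sT]]]] :=
    @core_of_lists G d (d + 4) (core_vertex_colors d) (core_edge_colors d)
      (core_pendant_colors d) Gd.
all: try by case: d d2 {Gd check} => [|[|[|d]]] //= _; apply/allP.
have kE : d + 4 + n.-1 = n + d + 3 by rewrite -{2}(prednK n_gt0); lia.
have := core_extend n.-1 core; rewrite kE -addnS => core_k.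
apply: (corona_colorable core_k) => v.
  by rewrite /= size_iota prednK.
have := allP check _ (aX v) => /allP/(_ _ (sT v)); case/orP=> [/eqP a_s|].
  by have := pend_vcol core v; rewrite inE a_s eqxx.
move=> /(copy_colorable_check H3); apply.
rewrite prodNE.
have -> : core_product a g (fun v => [:: s v] ++ iota (d + 5) n.-1) v =
    \prod_(y <- core_edge_colors d | y \in ecols g v) y
    * \prod_(c <- [:: a v, s v & iota (d + 5) n.-1]) c.
  rewrite /core_product /vertex_product (big_cons _ _ (a v)) mulnCA mulnA.
  congr (_ * _ * _).
  rewrite -[RHS]big_filter.
  transitivity (\prod_(c <- ecols g v) c).
    by rewrite big_map big_filter big_enum_cond.
  apply: perm_big; apply: uniq_perm.
  - rewrite map_inj_in_uniq ?nbrs_uniq // => w w'; rewrite !mem_nbrs => vw vw' E.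
    apply/eqP; apply: contra_eqT E => ww'.
    by apply: (ecol_adj (core_pair core) vw vw').
  - by rewrite filter_uniq //; clear -d2; case: d d2 => [|[|[|d]]].
  - move=> c; rewrite mem_filter; case: (boolP (c \in ecols g v)) => //= /mapP[w].
    by rewrite mem_nbrs => /gY gwY ->.
exact: mem_subproducts.
Qed.

End Main.

Theorem theorem1p1 (G H : graph) (subcubicG : subcubic G) (subcubicH : subcubic H) :
  npd_total_chromatic_number (corona G H) <= max_degree (corona G H) + 3.
Proof.
pose n := #|H|; pose d := max_degree G; pose k := n + d + 3.
apply: (@leq_trans k); last by rewrite leq_add2r max_degree_corona.
suff col : npd_total_colorable (corona G H) k.
  rewrite /npd_total_chromatic_number; case: ex_minnP => m _; apply.
  by rewrite col /k addn3.
have d3 : d <= 3 := subcubicG; have h_n := max_degree_lt H; rewrite -/n in h_n.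
(* The color 7 is a marker for k <= 13; a copy with at most three vertices has
   maximum degree at most two, so that k = 9 is enough for it. *)
have [big|small] := boolP ((9 < k) || ((n == 3) && (d == 3))).
  have [|||a [g [S [core S_size a7 g7 S7]]]] :=
    @core_avoiding G 7 n d k (leqnn _); rewrite /k; try lia.
  case: (ltnP 12 k) => k12; first exact: corona_plain core S_size subcubicH _.
  apply: (corona_colorable core) => // v.
  apply: (@copy_colorable_marked H (max_degree H) 7); rewrite ?leqnn ?a7 //.
  - by rewrite /k in k12 *; have : max_degree H <= 3 := subcubicH; lia.
  - by rewrite /k in k12 *; have : max_degree H <= 3 := subcubicH; lia.
  - by rewrite /k in k12 *; lia.
  - by move=> u; apply: (pend_range core (pendant_mem (S_size v) u)).
  - by move=> u; apply: contraNneq (S7 v) => <-; apply: pendant_mem.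
  have ndvd c : 0 < c <= k -> c != 7 -> ~~ (7 %| c).
    by move=> c_k c7; apply: ndvd_small; rewrite // /k in c_k k12 *; lia.
  have [pair _ S_range _ _ _] := core.
  rewrite /core_product Euclid_dvdM // negb_or vertex_product_ndvd //=.
  - rewrite big_seq ndvd_prod // => c cS; apply: ndvd; first exact: S_range cS.
    by apply: contraNneq (S7 v) => <-.
  - by rewrite ndvd // (vcol_range pair).
  - by move=> w vw; rewrite ndvd ?g7 // (ecol_range pair).
have n_gt0 : 0 < n := vertex_gt0 H.
case: (ltnP d 3) => [d2|d_ge3].
  apply: corona_checked => //.
  have d_in : d \in iota 0 3 by rewrite mem_iota.
  have n_in : n \in iota 1 (6 - d) by rewrite mem_iota; rewrite /k in small; lia.
  exact: (allP (allP small_check_all _ d_in)).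
have n2 : n <= 2 by rewrite /k in small; lia.
have [a [g [s core]]] := core_of_cut subcubicG.
have kE : 7 + n.-1 = k by rewrite /k; lia.
have := core_extend n.-1 core; rewrite kE => core_k.
apply: (corona_plain core_k) (leqnn (max_degree H)) _.
  by move=> v; rewrite /= size_iota prednK.
by rewrite /k; lia.
Qed.
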